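(* Let $m,k\geq 1$ be integers. Define the polynomials $$u(x)=x^{m+1}(x^{m+1}+x)^k-1,\qquad g(x)=(k+1)x^{m+1}+(k+m+1)x,$$ let $r_+$ be the unique positive real root of $u$, and put $T_{\mathrm{con}}=g(r_+)$. Then for every complex root $\alpha$ of $u$ we have $|g(\alpha)|\leq T_{\mathrm{con}}$. Moreover, equality $|g(\alpha)|=T_{\mathrm{con}}$ holds only if $\alpha=\zeta_m^d r_+$ for some $d\in\mathbb{Z}$, where $\zeta_m=e^{2\pi i/m}$, in which case $m\mid (k+1)d$ and $g(\alpha)=\zeta_m^d\,T_{\mathrm{con}}$.
   Context: The polynomial $u$ has exactly one positive real root, because $x\mapsto x^{m+1}(x^{m+1}+x)^k$ is strictly increasing on $(0,\infty)$, tends to $0$ as $x\to0^+$ and to $\infty$ as $x\to\infty$. Setting: with $n=m+k$ and $r=k-1$, the numbers $g(\alpha)$, for $\alpha$ ranging over the complex roots of $u$, are the critical values of the Laurent polynomial $f(x_1,\dots,x_n)=x_1+\dots+x_n+\frac{1}{x_1\cdots x_n}+\frac{1}{x_1\cdots x_{r+1}}$ on $(\mathbb{C}^* )^n$, which is the mirror of the blow-up of $\mathbb{P}^n$ along a linear subspace $\mathbb{P}^r$; $T_{\mathrm{con}}$ is the minimum value of $f$ on $(\mathbb{R}_{>0})^n$. This setting is not needed to interpret the claim. *)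

(* Defs.v *)
From mathcomp Require Export all_boot all_order all_algebra.
From mathcomp Require Export reals trigo.
From mathcomp Require Export complex.

Set Implicit Arguments.
Unset Strict Implicit.
Unset Printing Implicit Defensive.

Import Order.TTheory GRing.Theory Num.Theory.
Local Open Scope ring_scope.
Local Open Scope complex_scope.

(* [u] and [g] have integer coefficients; they are defined over an arbitrary
   ring so as to be used both over the reals and over the complex numbers. *)
Definition u (A : comNzRingType) (m k : nat) : {poly A} :=
  'X^(m.+1) * ('X^(m.+1) + 'X) ^+ k - 1.

Definition g (A : comNzRingType) (m k : nat) : {poly A} :=
  (k + 1)%:R *: 'X^(m.+1) + (k + m + 1)%:R *: 'X.

(* The libraries have no complex exponential: this is e^(i t) by Euler's
   formula. *)
Definition expi (R : realType) (t : R) : R[i] := cos t +i* sin t.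

Definition zeta (R : realType) (m : nat) : R[i] := expi (2 * pi / m%:R).

Lemma horner_u (A : comNzRingType) (m k : nat) (x : A) :
  (u A m k).[x] = x ^+ m.+1 * (x ^+ m.+1 + x) ^+ k - 1.
Proof. by rewrite /u !hornerE. Qed.

Lemma u_unique_pos_root (R : realType) (m k : nat) (hk : (1 <= k)%N) :
  exists! r : R, 0 < r /\ root (u R m k) r.
Proof.
have u0 : (u R m k).[0] <= 0 by rewrite horner_u expr0n /= mul0r sub0r lerN10.
have u1 : 0 <= (u R m k).[1].
  by rewrite horner_u expr1n mul1r subr_ge0 exprn_ege1 // lerDr ler01.
have incr x y : 0 < x -> x < y -> (u R m k).[x] < (u R m k).[y].
  move=> x0 xy; have y0 := lt_trans x0 xy.
  have lexy n : x ^+ n.+1 < y ^+ n.+1 by rewrite ltrXn2r ?ltW.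
  rewrite !horner_u ltrD2r ltr_pM ?exprn_ge0 ?addr_ge0 ?exprn_ge0 ?ltW //.
  by rewrite ltr_wpXn2r ?nnegrE ?addr_ge0 ?exprn_ge0 ?ltW ?ltrD.
have [r /andP[r0 _] ur] : exists2 r, 0 <= r <= 1 & root (u R m k) r.
  by apply: poly_ivt; rewrite ?ler01 // u0 u1.
exists r; split=> [|s [s0 us]].
  split=> //; rewrite lt_def r0 andbT; apply: contraTneq ur => ->.
  by rewrite rootE horner_u expr0n /= mul0r sub0r oppr_eq0 oner_eq0.
have rp : 0 < r.
  rewrite lt_def r0 andbT; apply: contraTneq ur => ->.
  by rewrite rootE horner_u expr0n /= mul0r sub0r oppr_eq0 oner_eq0.
case: (ltgtP r s) => // [rs|sr].
- by move: (incr _ _ rp rs); rewrite (rootP ur) (rootP us) ltxx.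
- by move: (incr _ _ s0 sr); rewrite (rootP ur) (rootP us) ltxx.
Qed.

(* Main.v *)
(** Let alpha be a root of u, rho = |alpha|, t = rho^m and s = |alpha^m + 1|,
    so that rho^(m+k+1) s^k = 1.  Eliminating Re(alpha^m) between the
    expressions of s^2 and of |g(alpha)|^2 gives
      |g(alpha)|^2 = rho^2 ((k+1)(k+m+1) s^2 - m(k+1) t^2 + m(k+m+1)),
    a function of rho alone, which is strictly decreasing on (0, oo).  The
    triangle inequality s <= 1 + t forces rho >= r_+, whence the bound.
    Equality forces rho = r_+ and then s = 1 + t, so alpha^m = r_+^m. *)

Require Import Defs.
From mathcomp Require Import normedtype sequences derive exp.
From mathcomp Require Import ring lra zify.

Set Implicit Arguments.
Unset Strict Implicit.
Unset Printing Implicit Defensive.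

Import Order.TTheory GRing.Theory Num.Theory.
Local Open Scope ring_scope.
Local Open Scope complex_scope.

Import numFieldNormedType.Exports.

Section ModulusProfile.
Variables (R : realType) (m k : nat).
Hypothesis k_gt0 : (0 < k)%N.

(* The value of |g(alpha)|^2 when |alpha| = e^(k x); this parametrization makes
   s = e^(-(m+k+1) x) free of k-th roots. *)
Definition modulus_profile (x : R) : R :=
  (k.+1 * (k + m).+1)%:R * expR (- (2 * m.+1)%:R * x)
  - (m * k.+1)%:R * expR ((2 * k * m.+1)%:R * x)
  + (m * (k + m).+1)%:R * expR ((2 * k)%:R * x).

Let dprofile (x : R) : R :=
  - (2 * m.+1 * (k.+1 * (k + m).+1))%:R * expR (- (2 * m.+1)%:R * x)
  - (2 * k * m.+1 * (m * k.+1))%:R * expR ((2 * k * m.+1)%:R * x)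
  + (2 * k * (m * (k + m).+1))%:R * expR ((2 * k)%:R * x).

Lemma is_derive_modulus_profile (x : R) :
  is_derive x (1 : R) modulus_profile (dprofile x).
Proof.
rewrite /modulus_profile /dprofile.
apply: is_derive_eq.
rewrite /GRing.scale /= !(natrM, natrD); ring.
Qed.

(** Only the [E3] term is positive, and its coefficient is at most that of either negative term. So
    a negative term whose exponential dominates [E3] absorbs it. Strictness comes from the
    coefficients in the [E1] case, from the spare [E1] term in the [E2] case. *)
Lemma dprofile_lt0 x : dprofile x < 0.
Proof.
have le_expR (a b : R) : a <= b -> expR a <= expR b by rewrite ler_expR.
rewrite /dprofile.
set E1 := expR (- _ * x); set E2 := expR ((2 * k * _)%:R * x).
set E3 := expR _.
have E1p : 0 < E1 := expR_gt0 _.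
have E2p : 0 < E2 := expR_gt0 _.
have E3p : 0 < E3 := expR_gt0 _.
have k1 : 1 <= k%:R :> R by rewrite ler1n.
have m0 : 0 <= m%:R :> R by [].
(* This is 1 <= s or 1 <= t, in terms of E3 = rho^2, E1 = rho^2 s^2 and
   E2 = rho^2 t^2: one of them holds according to whether rho <= 1. *)
have /orP[E31|E32] : (E3 <= E1) || (E3 <= E2).
  have [x0|x0] := leP x 0; apply/orP; [left | right]; apply: le_expR.
    apply: (@le_trans _ _ 0).
      by rewrite mulr_ge0_le0.
    by rewrite mulr_le0 // oppr_le0.
  by rewrite ler_pM2r // ler_nat leq_pmulr.
- have : 0 <= (2 * k * m.+1 * (m * k.+1))%:R * E2 by rewrite mulr_ge0 // ltW.
  suff : (2 * k * (m * (k + m).+1))%:R * E3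
         < (2 * m.+1 * (k.+1 * (k + m).+1))%:R * E1 by lra.
  apply: (@le_lt_trans _ _ ((2 * k * (m * (k + m).+1))%:R * E1)).
    by rewrite ler_wpM2l.
  rewrite ltr_pM2r // ltr_nat; nia.
- have : 0 < (2 * m.+1 * (k.+1 * (k + m).+1))%:R * E1 by rewrite mulr_gt0.
  suff : (2 * k * (m * (k + m).+1))%:R * E3
         <= (2 * k * m.+1 * (m * k.+1))%:R * E2 by lra.
  apply: (@le_trans _ _ ((2 * k * (m * (k + m).+1))%:R * E2)).
    by rewrite ler_wpM2l.
  rewrite ler_pM2r // ler_nat; nia.
Qed.

Lemma modulus_profile_decr (x y : R) :
  x < y -> modulus_profile y < modulus_profile x.
Proof.
move=> xy; rewrite -subr_lt0.
have [|c _ ->] := MVT xy (fun z _ => is_derive_modulus_profile z).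
  apply: derivable_within_continuous => z _.
  exact: (@ex_derive _ _ _ _ _ _ _ (is_derive_modulus_profile z)).
by rewrite pmulr_llt0 ?subr_gt0 // dprofile_lt0.
Qed.

End ModulusProfile.

Section ComplexModulus.
Variable R : rcfType.
Implicit Types z w : R[i].
Import Normc.

Lemma normcX z n : normc (z ^+ n) = normc z ^+ n.
Proof.
by elim: n => [|n IH]; rewrite ?expr0 ?normc1 // !exprS normcM IH.
Qed.

Lemma normc_ge0 z : 0 <= normc z.
Proof. by case: z => a b; exact: sqrtr_ge0. Qed.

Lemma normc_real (r : R) : 0 <= r -> normc r%:C = r.
Proof. by move=> r0; rewrite /= expr0n addr0 sqrtr_sqr ger0_norm. Qed.

(** Expanding the left side leaves 2pq Re z, which is replaced using 2 Re z = |z + 1|^2 - |z|^2 -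
    1. *)
Lemma normc_affine (p q : R) z :
  normc (p%:C * z + q%:C) ^+ 2 =
  p * q * normc (z + 1) ^+ 2 - p * (q - p) * normc z ^+ 2 + q * (q - p).
Proof.
case: z => a b.
have -> : p%:C * (a +i* b) + q%:C = (p * a + q) +i* (p * b).
  by simpc.
have -> : a +i* b + 1 = (a + 1) +i* b by simpc.
by rewrite /normc !sqr_sqrtr ?addr_ge0 ?sqr_ge0 //; ring.
Qed.

(** Equality case of the triangle inequality: the difference of the squared hypotheses gives Re z =
    t, and then |z| = t forces Im z = 0. *)
Lemma normcD_eq_real z (t : R) :
  0 <= t -> normc z = t -> normc (z + 1) = t + 1 -> z = t%:C.
Proof.
case: z => a b t0 /(congr1 (fun v => v ^+ 2)) + /(congr1 (fun v => v ^+ 2)).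
have -> : a +i* b + 1 = (a + 1) +i* b by simpc.
rewrite /normc !sqr_sqrtr ?addr_ge0 ?sqr_ge0 // => e1 e2.
have ea : a = t by lra.
have /eqP : b ^+ 2 = 0 by move: e1; rewrite ea; lra.
by rewrite sqrf_eq0 ea => /eqP ->.
Qed.

End ComplexModulus.

Section RootsOfUnity.
Variable R : realType.

Lemma expiX (t : R) n : expi t ^+ n = expi (n%:R * t).
Proof.
elim: n => [|n IH]; first by rewrite mul0r /expi cos0 sin0.
by rewrite exprS IH /expi mulrS mulrDl mul1r cosD sinD; simpc;
  rewrite [X in _ +i* X]addrC.
Qed.

(** If the order n were less than m, the angle pi n/m would lie in (0, pi) and have positive sine,
    whereas the cosine of its double being 1 makes that sine vanish. *)
Lemma zeta_primitive m : (0 < m)%N -> m.-primitive_root (zeta R m).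
Proof.
move=> m_gt0; have mR : 0 < m%:R :> R by rewrite ltr0n.
have zetaX n : zeta R m ^+ n = expi (2 * (pi * (n%:R / m%:R))).
  by rewrite expiX; congr expi; field; rewrite gt_eqF.
have : zeta R m ^+ m = 1.
  by rewrite zetaX divff ?gt_eqF // mulr1 mulr_natl /expi cos2pi sin2pi.
move=> /(prim_order_exists m_gt0)[n zn]; move: (prim_order_gt0 zn) => n_gt0.
move=> /(dvdn_leq m_gt0); rewrite leq_eqVlt => /predU1P[n_m|lt_nm].
  by rewrite -{1}n_m.
have : 0 < sin (pi * (n%:R / m%:R) : R).
  apply: sin_gt0_pi; apply/andP; split.
    by rewrite mulr_gt0 ?pi_gt0 // divr_gt0 // ltr0n.
  by rewrite gtr_pMr ?pi_gt0 // ltr_pdivrMr // mul1r ltr_nat.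
have := prim_expr_order zn; rewrite zetaX => -[+ _].
rewrite mulr_natl cos_mulr2n => cos_eq sin_gt0.
have := cos2Dsin2 (pi * (n%:R / m%:R) : R).
have : 0 < sin (pi * (n%:R / m%:R) : R) ^+ 2 by rewrite exprn_gt0.
lra.
Qed.

End RootsOfUnity.

Section RootsOfU.
Variables (R : realType) (m k : nat).
Hypothesis k_gt0 : (0 < k)%N.
Import Normc.
Implicit Types alpha : R[i].

Lemma horner_g (A : comNzRingType) (x : A) :
  (g A m k).[x] = x * (k.+1%:R * x ^+ m + (k + m).+1%:R).
Proof. by rewrite /g !hornerE !addn1 exprS; ring. Qed.

Lemma rmorph_g (r : R) : (g R[i] m k).[r%:C] = ((g R m k).[r])%:C.
Proof. by rewrite !horner_g !(rmorphM, rmorphD, rmorphXn, rmorph_nat). Qed.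

Lemma root_u_eq (A : comNzRingType) (x : A) :
  root (u A m k) x -> x ^+ (m + k).+1 * (x ^+ m + 1) ^+ k = 1.
Proof.
rewrite rootE horner_u subr_eq0 => /eqP u_eq1; rewrite -[RHS]u_eq1.
have -> : x ^+ m.+1 + x = x * (x ^+ m + 1) by rewrite exprS; ring.
by rewrite exprMn mulrA -exprD addSn.
Qed.

Lemma root_u_modulus alpha : root (u R[i] m k) alpha ->
  exists x : R, normc alpha = expR (k%:R * x)
    /\ normc (alpha ^+ m + 1) = expR (- (m + k).+1%:R * x).
Proof.
move=> /root_u_eq/(congr1 (@normc R)); rewrite normcM !normcX normc1.
set rho := normc alpha; set s := normc _ => rho_s.
have kR : k%:R != 0 :> R by rewrite pnatr_eq0 -lt0n.
have rho_gt0 : 0 < rho.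
  rewrite lt_def normc_ge0 andbT; apply: contra_eq_neq rho_s => ->.
  by rewrite expr0n mul0r eq_sym oner_eq0.
have s_gt0 : 0 < s.
  rewrite lt_def normc_ge0 andbT; apply: contra_eq_neq rho_s => ->.
  by rewrite expr0n eqn0Ngt k_gt0 mulr0 eq_sym oner_eq0.
have [x ex] := expR_total rho_gt0; have [y ey] := expR_total s_gt0.
(* Here [x] is log rho and [y] is log s; the logarithm of rho^(m+k+1) s^k = 1 determines [y] from
   [x]. *)
exists (x / k%:R); rewrite mulrC divfK // ex; split=> //.
rewrite -ey; congr expR; apply: (mulfI kR).
move: rho_s; rewrite -ex -ey -!expRM_natl -expRD -[RHS]expR0 => /expR_inj.
have -> : k%:R * (- (m + k).+1%:R * (x / k%:R)) = - ((m + k).+1%:R * x).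
  by field.
lra.
Qed.

Lemma normc_g_profile alpha (x : R) : normc alpha = expR (k%:R * x) ->
    normc (alpha ^+ m + 1) = expR (- (m + k).+1%:R * x) ->
  normc (g R[i] m k).[alpha] ^+ 2 = modulus_profile m k x.
Proof.
move=> e1 e2; rewrite horner_g normcM exprMn.
(* Taken with p = k+1, q = k+m+1 and z = alpha^m, so that q - p = m. *)
rewrite -!(rmorph_nat (real_complex R)) normc_affine normcX e1 e2.
rewrite /modulus_profile -!expRM_natl.
have -> : expR (- (2 * m.+1)%:R * x) =
    expR (2 * (k%:R * x)) * expR (2 * (- (m + k).+1%:R * x)).
  by rewrite -expRD; congr expR; ring.
have -> : expR ((2 * k * m.+1)%:R * x) =
    expR (2 * (k%:R * x)) * expR (2 * (m%:R * (k%:R * x))).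
  by rewrite -expRD; congr expR; ring.
have -> : expR ((2 * k)%:R * x) = expR (2 * (k%:R * x)).
  by congr expR; ring.
ring.
Qed.

End RootsOfU.

Theorem theorem1p4 (R : realType) (m k : nat) (hm : (1 <= m)%N) (hk : (1 <= k)%N)
    (rplus : R) (rplus_gt0 : 0 < rplus) (rplus_root : root (u R m k) rplus)
    (Tcon : R) (Tcon_def : Tcon = (g R m k).[rplus])
    (alpha : R[i]) (alpha_root : root (u R[i] m k) alpha) :
  `|(g R[i] m k).[alpha]| <= Tcon%:C
  /\ (`|(g R[i] m k).[alpha]| = Tcon%:C ->
      exists d : int,
        [/\ alpha = zeta R m ^ d * rplus%:C,
            (m%:Z %| (k + 1)%:Z * d)%Z &
            (g R[i] m k).[alpha] = zeta R m ^ d * Tcon%:C]).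
Proof.
pose N := @Normc.normc R.
have root_C : root (u R[i] m k) rplus%:C.
  move: rplus_root; rewrite !rootE !horner_u => /eqP/(congr1 (real_complex R)).
  by rewrite !(rmorphB, rmorphM, rmorphXn, rmorphD) rmorph1 rmorph0 => ->.
have g_rplus : (g R[i] m k).[rplus%:C] = Tcon%:C by rewrite rmorph_g Tcon_def.
have Tcon_ge0 : 0 <= Tcon.
  by rewrite Tcon_def horner_g mulr_ge0 ?addr_ge0 ?mulr_ge0 ?exprn_ge0 // ltW.
have [x [Nx sx]] := root_u_modulus hk alpha_root.
have [x0 [Nx0 sx0]] := root_u_modulus hk root_C.
have gx := normc_g_profile Nx sx; have gx0 := normc_g_profile Nx0 sx0.
rewrite g_rplus normc_real // in gx0.
have kR : 0 < k%:R :> R by rewrite ltr0n.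
have s0E : N (rplus%:C ^+ m + 1) = N rplus%:C ^+ m + 1.
  rewrite -rmorphXn -(rmorph1 (real_complex R)) -rmorphD /N !normc_real //.
    by rewrite ltW.
  by rewrite addr_ge0 ?exprn_ge0 // ltW.
have le_sx : N (alpha ^+ m + 1) <= N alpha ^+ m + 1.
  by rewrite -normcX -[1 in leRHS]Normc.normc1 le_normcD.
(* If [x < x0], then |alpha| < r_+ while |alpha^m + 1| > r_+^m + 1, against the triangle inequality
   [le_sx]. *)
have le_x0x : x0 <= x.
  rewrite leNgt; apply/negP => lt_xx0.
  have : N (rplus%:C ^+ m + 1) < N (alpha ^+ m + 1).
    by rewrite /N sx sx0 ltr_expR ltr_nM2l // oppr_lt0.
  rewrite s0E => /lt_le_trans/(_ le_sx); rewrite ltrD2r; apply/negP.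
  rewrite -leNgt ler_pXn2r ?nnegrE ?normc_ge0 //.
  by rewrite /N Nx Nx0 ler_expR ler_pM2l // ltW.
have normE (z : R[i]) : `|z| = (N z)%:C by [].
have le_T : N (g R[i] m k).[alpha] <= Tcon.
  rewrite -(@ler_pXn2r _ 2) ?nnegrE ?normc_ge0 // /N gx gx0.
  move: le_x0x; rewrite le_eqVlt => /predU1P[-> // | lt_x0x].
  by rewrite ltW // modulus_profile_decr.
split; first by rewrite normE lecR.
rewrite normE => -[eq_T].
have eq_x : x = x0.
  apply/eqP; rewrite eq_le le_x0x andbT leNgt; apply/negP => lt_x0x.
  by have := modulus_profile_decr m hk lt_x0x; rewrite -gx -gx0 -/N eq_T ltxx.
have rplusC_neq0 : rplus%:C != 0 by rewrite fmorph_eq0 gt_eqF.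
have alpha_m : alpha ^+ m = rplus%:C ^+ m.
  rewrite -[RHS]rmorphXn; apply: normcD_eq_real.
  - by rewrite exprn_ge0 // ltW.
  - by rewrite normcX Nx eq_x -Nx0 normc_real // ltW.
  - by rewrite sx eq_x -sx0 -/N s0E /N normc_real // ltW.
have prim_zeta := zeta_primitive R hm.
have [i ei] : {i : 'I_m | alpha / rplus%:C = zeta R m ^+ i}.
  apply: (prim_rootP prim_zeta).
  by rewrite expr_div_n alpha_m divff // expf_neq0.
have alphaE : alpha = zeta R m ^+ i * rplus%:C by rewrite -ei divfK.
exists (i : nat)%:Z; split.
- by rewrite alphaE.
(* The divisibility amounts to (alpha / r_+)^(k+1) = 1. Since alpha^m = r_+^m, the factors (x^m +
   1)^k and x^m cancel between the equations of the two roots, leaving alpha^(k+1) = r_+^(k+1). *)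
- rewrite -PoszM dvdzE /= addn1 (prim_order_dvd prim_zeta) mulnC exprM -ei.
  have := etrans (root_u_eq alpha_root) (esym (root_u_eq root_C)).
  have w_neq0 : (rplus%:C ^+ m + 1) ^+ k != 0.
    apply: contra_eq_neq (root_u_eq root_C) => ->.
    by rewrite mulr0 eq_sym oner_eq0.
  rewrite alpha_m => /(mulIf w_neq0).
  rewrite -addnS !exprD alpha_m => /(mulfI (expf_neq0 m rplusC_neq0)) alpha_k.
  by rewrite expr_div_n alpha_k divff // expf_neq0.
(* g(x) is x times a function of x^m, so it scales by the same root of unity as x. *)
- by rewrite -g_rplus !horner_g alpha_m mulrA -exprnP -alphaE.
Qed.
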